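(* Let $d\geq 1$, let $p\in\mathbb{R}^d$ be a point, and let $k\geq 1$ be a natural number. Let $X\subset\mathbb{R}^d$ be a set of $k(d+1)$ points, each colored with one of $d+1$ colors $0,1,\ldots,d$, such that each color class $C_0,C_1,\ldots,C_d$ contains exactly $k$ points, and such that $X\cup\{p\}$ is in general position. Let $\mathrm{cBP}_k(X)$ denote the number of unordered colored Birch partitions of $X$ to the point $p$. Then: \begin{enumerate} \item[(i)] $\mathrm{cBP}_k(X)$ is even whenever $k\geq d+2$. \item[(ii)] If $d=1$ and $\mathrm{cBP}_k(X)>0$, then $\mathrm{cBP}_k(X)\geq \lceil k/2\rceil!\cdot\lfloor k/2\rfloor!$. \item[(iii)] If $d=2$, $k\geq 6$ and $\mathrm{cBP}_k(X)>0$, then $\mathrm{cBP}_k(X)\geq 8\cdot 3^{k-6}$. \item[(iv)] If $d\geq 2$, $k\geq d+2$ and $\mathrm{cBP}_k(X)>0$, then $\mathrm{cBP}_k(X)\geq 2^{k-d-1}$. \end{enumerate}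
   Context: A finite set of points in $\mathbb{R}^d$ is in general position if no $m+2$ of its points lie on a common $m$-dimensional affine subspace. Given a point $p\in\mathbb{R}^d$ and a set $X$ of $k(d+1)$ points colored with $d+1$ colors so that each color class $C_0,\ldots,C_d$ has exactly $k$ points, a colored Birch partition of $X$ to $p$ is a partition of $X$ into $k$ blocks $B_1,\ldots,B_k$ such that each block contains exactly $d+1$ points, contains exactly one point of each color $0,1,\ldots,d$, and satisfies $p\in\mathrm{conv}(B_i)$. The partitions are counted unordered: two partitions are the same if one is obtained from the other by permuting the blocks. *)

(* Defs.v *)
From HB Require Import structures.
From mathcomp Require Import all_boot all_order all_algebra finmap.
From mathcomp Require Import boolp reals.

Set Implicit Arguments.
Unset Strict Implicit.
Unset Printing Implicit Defensive.

Import GRing.Theory Num.Theory.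

Local Open Scope fset_scope.
Local Open Scope ring_scope.

(* The dimension m ranges over m < d only: for m >= d every set of points lies
   in the whole space.  The case m = d - 1 says that no d + 1 points lie on a
   common hyperplane.  An m-dimensional affine subspace is written a + U. *)
Definition general_position (R : realType) (d : nat)
    (A : {fset 'rV[R]_d}) : Prop :=
  forall (m : nat) (a : 'rV[R]_d) (U : {vspace 'rV[R]_d}) (S : {fset 'rV[R]_d}),
    (m < d)%N -> (\dim U)%VS = m -> S `<=` A -> #|` S| = m.+2 ->
    ~ (forall x, x \in S -> x - a \in U).

(* [q] lies in the convex hull of the finite family of points [x i], [i \in B]. *)
Definition in_conv (R : realType) (V : lmodType R) (I : finType)
    (x : I -> V) (B : {set I}) (q : V) : Prop :=
  exists w : I -> R,
    [/\ forall i, i \in B -> 0 <= w i,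
        \sum_(i in B) w i = 1
      & q = \sum_(i in B) w i *: x i].

Section ColoredBirchPartitions.
Variables (R : realType) (d : nat) (p : 'rV[R]_d) (X : {fset 'rV[R]_d}).
Variable (col : X -> 'I_d.+1).

(* Below X is coerced to the finite type of its elements. *)
Definition color_class (i : 'I_d.+1) : {set X} := [set x | col x == i].

Definition birch_block (B : {set X}) : bool :=
  [&& #|B| == d.+1,
      [forall i : 'I_d.+1, #|B :&: color_class i| == 1%N]
    & `[< in_conv (fun x : X => val x) B p >] ].

Definition colored_birch_partition (k : nat) (P : {set {set X}}) : bool :=
  [&& partition P [set: X], #|P| == k & [forall B in P, birch_block B] ].

(* A partition is a set of blocks, so partitions are counted unordered. *)
Definition cBP (k : nat) : nat :=
  #|[set P : {set {set X}} | colored_birch_partition k P]|.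

End ColoredBirchPartitions.

(* Main.v *)
(* Let r be a generic direction.  For a rainbow set B avoiding p, a ray from p
   in direction r shows that, modulo 2, [p in conv B] is the sum over the
   colours i of [r in the cone at p of B without its point of colour i].  Hence
   the number of Birch partitions is, modulo 2, a sum over maps phi from blocks
   to colours of a sum over all rainbow partitions.  With k >= d + 2 blocks two
   of them get the same colour i under phi, and exchanging their points of
   colour i is a fixed-point-free involution preserving the summand: the count
   is even.

   Consequently a partition with at least d + 2 blocks is never the only one, so
   some point lies in two different blocks of Birch partitions, and the count at
   least doubles with each additional block.  As soon as there are 2d + 3 blocks
   some point even lies in three different blocks, whence the factor 3.  On the
   line, the points of the blocks of a given orientation can be rematched freely.
*)
Require Import Defs.
From mathcomp Require Import all_boot all_order all_fingroup all_algebra finmap.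
From mathcomp Require Import zify ring lra boolp reals.

Set Implicit Arguments.
Unset Strict Implicit.
Unset Printing Implicit Defensive.

Import Order.TTheory GRing.Theory Num.Theory.

(** * Exchanging points in rainbow partitions *)

(** Each orbit [{x, s x}] has two elements and contributes [w x] twice, which cancels modulo 2. *)
Lemma addb_involution (T : finType) (D : {set T}) (s : T -> T) (w : T -> bool) :
  (forall x, x \in D -> [/\ s x \in D, s (s x) = x, s x != x & w (s x) = w x]) ->
  \big[addb/false]_(x in D) w x = false.
Proof.
(* Comparing ranks selects one element of each orbit; [s] carries the other half of the sum onto
   this one. *)
move=> sP; rewrite (bigID (fun x => enum_rank x < enum_rank (s x))) /=.
rewrite [X in _ (+) X](reindex_onto s s); last first.
  by move=> x /andP[xD _]; have [] := sP x xD.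
rewrite -[RHS](addbb (\big[addb/false]_(x in D | enum_rank x < enum_rank (s x)) w x)).
congr addb; apply: eq_big => [x|x /andP[/andP[sxD _] /eqP ssx]].
  apply/idP/idP => [/andP[/andP[sxD]]|/andP[xD ltx]].
    rewrite -leqNgt => + /eqP ssx; rewrite ssx => lex.
    have [xD _] := sP _ sxD; rewrite ssx in xD => nex _; rewrite xD /=.
    rewrite ltn_neqAle lex andbT; apply: contra nex => /eqP eqx.
    by rewrite ssx; apply/eqP/enum_rank_inj/val_inj.
  have [-> ssx _ _] := sP _ xD; rewrite ssx eqxx andbT /=.
  by rewrite -leqNgt ltnW.
by have [xD _ _] := sP _ sxD; rewrite ssx => ->.
Qed.

Lemma odd_card (T : finType) (D : {set T}) (f : pred T) :
  odd #|[set x in D | f x]| = \big[addb/false]_(x in D) f x.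
Proof.
rewrite -sum1_card (big_morph odd oddD (erefl : odd 0 = false)).
rewrite big_mkcond [RHS]big_mkcond; apply: eq_bigr => x _.
by rewrite inE; case: (x \in D); case: (f x).
Qed.

Section Rainbow.
Variables (T I : finType) (col : T -> I).

Definition hue (i : I) : {set T} := [set x | col x == i].

Definition rainbow (B : {set T}) : bool := [forall i, #|B :&: hue i| == 1%N].

Definition rainbow_partitions (Y : {set T}) : {set {set {set T}}} :=
  [set P | partition P Y & [forall B in P, rainbow B]].

Lemma rainbow_inj (B : {set T}) :
  rainbow B -> {in B &, injective col}.
Proof.
move=> /forallP rB x y xB yB exy.
have /cards1P[z Bz] := rB (col x).
have: x \in B :&: hue (col x) by rewrite !inE xB eqxx.
have: y \in B :&: hue (col x) by rewrite !inE yB exy eqxx.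
by rewrite Bz !inE => /eqP -> /eqP ->.
Qed.

Lemma rainbow_ex (B : {set T}) (i : I) :
  rainbow B -> exists2 x, x \in B & col x = i.
Proof.
move=> /forallP/(_ i)/cards1P[x Bx]; exists x.
  by have: x \in B :&: hue i by [rewrite Bx set11]; rewrite inE => /andP[].
have: x \in B :&: hue i by rewrite Bx set11.
by rewrite !inE => /andP[_ /eqP].
Qed.

(** The fallback [dflt] makes the function total; a rainbow set meets every colour and never reaches
    it. *)
Definition point (dflt : T) (B : {set T}) (i : I) : T :=
  odflt dflt [pick x in B :&: hue i].

Lemma pointP dflt B i : rainbow B ->
  point dflt B i \in B /\ col (point dflt B i) = i.
Proof.
move=> rB; rewrite /point; case: pickP => [x|/=].
  by rewrite !inE => /andP[xB /eqP].
have [x xB cx] := rainbow_ex i rB.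
by move=> /(_ x); rewrite !inE xB cx eqxx.
Qed.

Lemma point_eq dflt B i x : rainbow B -> x \in B -> col x = i ->
  point dflt B i = x.
Proof.
move=> rB xB cx; have [pB pc] := pointP dflt i rB.
by apply: (rainbow_inj rB) => //; rewrite pc cx.
Qed.

Lemma rainbow_imset (s : {perm T}) (B : {set T}) :
  (forall x, col (s x) = col x) -> rainbow B -> rainbow (s @: B).
Proof.
move=> sc /forallP rB; apply/forallP => i.
suff -> : s @: B :&: hue i = s @: (B :&: hue i) by rewrite card_imset //; apply: perm_inj.
apply/setP => y; rewrite !inE; apply/andP/imsetP => [[/imsetP[x xB ->]]|[x + ->]].
  by rewrite sc => cx; exists x; rewrite // !inE xB.
by rewrite !inE sc => /andP[xB ->]; rewrite imset_f.
Qed.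

Lemma card_rainbow (B : {set T}) : rainbow B -> #|B| = #|I|.
Proof.
move=> rB; rewrite -(card_in_imset (rainbow_inj rB)) -[RHS]cardsT.
congr #|pred_of_set _|; apply/setP => i; rewrite inE.
by have [x xB <-] := rainbow_ex i rB; rewrite imset_f.
Qed.

(** A block has exactly one point of each colour, so [pblock P] maps the points of colour [i] in [Y]
    bijectively onto the blocks of [P]. *)
Lemma card_hue_pblock (Q : pred {set T}) (P : {set {set T}}) (Y : {set T}) (i : I) :
  P \in rainbow_partitions Y ->
  #|[set x in Y :&: hue i | Q (pblock P x)]| = #|[set B in P | Q B]|.
Proof.
rewrite inE => /andP[pP /forall_inP rP].
have tP := partition_trivIset pP; have cP := cover_partition pP.
have pbP x : x \in Y -> pblock P x \in P /\ x \in pblock P x.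
  by rewrite -cP => xY; rewrite pblock_mem // mem_pblock.
rewrite -[LHS](card_in_imset (f := pblock P)).
  congr #|pred_of_set _|; apply/setP => B; rewrite inE; apply/imsetP/andP.
    by move=> [x]; rewrite !inE => /andP[/andP[/pbP[xP _] _] Qx] ->.
  move=> [BP QB]; have [x xB cx] := rainbow_ex i (rP _ BP).
  exists x; rewrite ?(def_pblock tP BP xB) // !inE (def_pblock tP BP xB) QB cx eqxx !andbT.
  by rewrite (subsetP (partitionS pP BP)).
move=> x y; rewrite !inE => /andP[/andP[/pbP[xP xx] /eqP cx] _] /andP[/andP[/pbP[_ yy] /eqP cy] _] e.
by apply: (rainbow_inj (rP _ xP)); rewrite ?cx ?cy // e.
Qed.

(** * Exchanging the points of one colour between two blocks *)

Section Swap.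
Variables (i : I) (a a' : T).

(** The two blocks are addressed through labels [a] and [a'], later two points of equal colour,
    which may themselves be the points exchanged. *)
Definition transp (P : {set {set T}}) : {perm T} :=
  tperm (point a (pblock P a) i) (point a (pblock P a') i).

Definition swap (P : {set {set T}}) : {set {set T}} :=
  [set transp P @: B | B : {set T} in P].

Variables (Y : {set T}) (P : {set {set T}}).
Hypotheses (aY : a \in Y) (aY' : a' \in Y) (neqa : a != a').
Hypotheses (caa' : col a = col a') (PY : P \in rainbow_partitions Y).

Let partP : partition P Y. Proof. by move: PY; rewrite inE => /andP[]. Qed.
Let trivP := partition_trivIset partP.
Let rain B : B \in P -> rainbow B.
Proof. by move: PY; rewrite inE => /andP[_ /forall_inP]; apply. Qed.
Let coverP : cover P = Y := cover_partition partP.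
Let pblockP y : y \in Y -> pblock P y \in P /\ y \in pblock P y.
Proof. by rewrite -coverP => yY; rewrite pblock_mem // mem_pblock. Qed.
Let x := point a (pblock P a) i.
Let x' := point a (pblock P a') i.

Let xP : x \in pblock P a /\ col x = i.
Proof. by apply: pointP; apply: rain; case: (pblockP aY). Qed.
Let xP' : x' \in pblock P a' /\ col x' = i.
Proof. by apply: pointP; apply: rain; case: (pblockP aY'). Qed.

Let sE : transp P = tperm x x'. Proof. by []. Qed.

Let blocks_neq : pblock P a != pblock P a'.
Proof.
apply: contra neqa => /eqP eqP'; have [aP aa] := pblockP aY.
have [_ aa'] := pblockP aY'; rewrite -eqP' in aa'.
by apply/eqP/(rainbow_inj (rain aP)).
Qed.

Let pbx : pblock P x = pblock P a.
Proof. by apply: same_pblock => //; case: xP. Qed.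
Let pbx' : pblock P x' = pblock P a'.
Proof. by apply: same_pblock => //; case: xP'. Qed.

Let neqx : x != x'.
Proof. by apply: contra blocks_neq => /eqP e; rewrite -pbx -pbx' e. Qed.

Lemma transp_col y : col (transp P y) = col y.
Proof.
rewrite sE; case: tpermP => [->|->|//].
  by rewrite (proj2 xP) (proj2 xP').
by rewrite (proj2 xP) (proj2 xP').
Qed.

Lemma transp_neq y : col y != i -> transp P y = y.
Proof.
move=> cy; rewrite sE tpermD //; apply: contra cy => /eqP <-.
  by rewrite (proj2 xP).
by rewrite (proj2 xP').
Qed.

Let xY : x \in Y.
Proof. by rewrite -coverP; apply/bigcupP; exists (pblock P a); [case: (pblockP aY)|case: xP]. Qed.
Let xY' : x' \in Y.
Proof. by rewrite -coverP; apply/bigcupP; exists (pblock P a'); [case: (pblockP aY')|case: xP']. Qed.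

Let sY y : y \in Y -> transp P y \in Y.
Proof. by rewrite sE; case: tpermP => [->|->|]. Qed.

Lemma swap_rainbow_partition : swap P \in rainbow_partitions Y.
Proof.
rewrite inE; apply/andP; split.
  have sYY : [set transp P y | y in Y] = Y.
    apply/eqP; rewrite eqEcard card_imset ?leqnn ?andbT; last exact: perm_inj.
    by apply/subsetP => _ /imsetP[y yY ->]; apply: sY.
  by rewrite -[X in partition _ X]sYY imset_partition //; apply: perm_inj.
apply/forall_inP => _ /imsetP[B BP ->].
by apply: rainbow_imset (rain BP); apply: transp_col.
Qed.

Lemma pblock_swap y : y \in Y -> pblock (swap P) (transp P y) = transp P @: pblock P y.
Proof.
move=> yY; have [pP yp] := pblockP yY.
apply: def_pblock; rewrite ?imset_f //.
by rewrite imset_trivIset //; apply: perm_inj.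
Qed.

Let pblock_swap_fix y : y \in Y -> transp P y = y -> pblock (swap P) y = transp P @: pblock P y.
Proof. by move=> yY {1}<-; apply: pblock_swap. Qed.

Let rain_swap y : y \in Y -> rainbow (transp P @: pblock P y).
Proof.
by move=> yY; apply: rainbow_imset (rain _); [exact: transp_col|case: (pblockP yY)].
Qed.

(** This makes the exchange an involution. If the labels have colour [i], they are the exchanged
    points and remain so; otherwise the labels stay in place and the two points of colour [i] trade
    roles. *)
Lemma transp_swap : transp (swap P) = transp P.
Proof.
rewrite [LHS]/transp.
have [ca|ca] := eqVneq (col a) i.
  have xa : x = a.
    by case: (pblockP aY) => /rain rB aB; rewrite /x; apply: point_eq.
  have xa' : x' = a'.
    by case: (pblockP aY') => /rain rB aB; rewrite /x'; apply: point_eq; rewrite -?caa'.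
  have ea : transp P a' = a by rewrite sE xa xa' tpermR.
  have ea' : transp P a = a' by rewrite sE xa xa' tpermL.
  have -> : pblock (swap P) a = transp P @: pblock P a' by rewrite -ea pblock_swap.
  have -> : pblock (swap P) a' = transp P @: pblock P a by rewrite -[in LHS]ea' pblock_swap.
  rewrite (@point_eq _ _ _ a) ?rain_swap //; last first.
    by rewrite -[X in X \in _]ea imset_f //; case: (pblockP aY').
  rewrite (@point_eq _ _ _ a') ?rain_swap //; last by rewrite -caa'.
    by rewrite sE xa xa'.
  by rewrite -[X in X \in _]ea' imset_f //; case: (pblockP aY).
rewrite !pblock_swap_fix ?transp_neq -?caa' //.
rewrite (@point_eq _ _ _ x') ?rain_swap ?(proj2 xP') //; last first.
  apply/imsetP; exists x; first by case: xP.
  by rewrite sE tpermL.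
rewrite (@point_eq _ _ _ x) ?rain_swap ?(proj2 xP) //; last first.
  apply/imsetP; exists x'; first by case: xP'.
  by rewrite sE tpermR.
by rewrite tpermC.
Qed.

Lemma swapK : swap (swap P) = P.
Proof.
rewrite {1}/swap transp_swap /swap -imset_comp -[RHS]imset_id.
apply: eq_imset => B /=; rewrite -imset_comp -[RHS]imset_id.
by apply: eq_imset => y /=; rewrite /transp tpermK.
Qed.

(** A second colour anchors the block of [a]: its point [y] of colour [j] does not move, while its
    companion of colour [i] becomes [x'], which lies in another block of [P]. *)
Lemma swap_neq : (1 < #|I|)%N -> swap P != P.
Proof.
move=> I2; apply/eqP => eqP'.
have [j ji] : exists j, j != i.
  have: (0 < #|predC1 i|)%N by rewrite cardC1; case: #|I| I2 => [|[]].
  by case/card_gt0P => j; exists j.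
have [aP _] := pblockP aY; have rB := rain aP.
have [y yB cy] := rainbow_ex j rB.
have sy : transp P y = y by apply: transp_neq; rewrite cy.
have yY : y \in Y by rewrite -coverP; apply/bigcupP; exists (pblock P a).
have := pblock_swap_fix yY sy; rewrite eqP' (same_pblock trivP yB) => e.
have : x' \in pblock P a.
  rewrite e; apply/imsetP; exists x; first by case: xP.
  by rewrite sE tpermL.
move=> x'B; have := neqx; rewrite (_ : x = x') ?eqxx //.
by apply: (rainbow_inj rB) => //; case: xP xP' => // ? -> [].
Qed.

Lemma imset_transpD (B : {set T}) : (transp P @: B) :\: hue i = B :\: hue i.
Proof.
apply/setP => y; rewrite !inE; have [//|/transp_neq sy /=] := eqVneq (col y) i.
by rewrite -{1}sy mem_imset //; apply: perm_inj.
Qed.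

Let pblock_swap_other b :
  b \in Y -> col b = col a -> b != a -> b != a' -> pblock (swap P) b = pblock P b.
Proof.
move=> bY cb nba nba'; have [bP bB] := pblockP bY.
have nin c z : c \in Y -> col c = col b -> b != c -> z \in pblock P c -> z \notin pblock P b.
  move=> cY cc nbc zc; apply: contra nbc => zb; have [cP cB] := pblockP cY.
  move: cB; rewrite -(same_pblock trivP zc) (same_pblock trivP zb) => cB.
  by apply/eqP; apply: (rainbow_inj (rain bP)).
have sb y : y \in pblock P b -> transp P y = y.
  move=> yb; rewrite sE tpermD //.
    by apply: contraTneq yb => <-; apply: (nin a); case: xP.
  by apply: contraTneq yb => <-; apply: (nin a'); rewrite -?caa' //; case: xP'.
rewrite -{1}(sb b bB) pblock_swap // -[RHS]imset_id.
by apply: eq_in_imset => y /sb.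
Qed.

(** Each factor ignores colour [phi b]. If [i != c0], the labels stay put and their blocks change
    only in the ignored colour; if [i = c0], the two truncated blocks trade labels, which the last
    hypothesis absorbs. Blocks with other labels are unchanged. *)
Lemma swap_prod (h : T -> I -> {set T} -> bool) (phi : T -> I) (c0 : I) :
  col a = c0 -> phi a = i -> phi a' = i ->
  (i = c0 -> forall S S', h a i S && h a' i S' = h a i S' && h a' i S) ->
  \big[andb/true]_(b in Y :&: hue c0) h b (phi b) (pblock (swap P) b :\: hue (phi b)) =
  \big[andb/true]_(b in Y :&: hue c0) h b (phi b) (pblock P b :\: hue (phi b)).
Proof.
move=> ca pa pa' hC.
have aA : a \in Y :&: hue c0 by rewrite !inE aY ca eqxx.
have aA' : a' \in (Y :&: hue c0) by rewrite !inE aY' -caa' ca eqxx.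
rewrite (bigD1 a) // (bigD1 a') /=; last by rewrite aA' eq_sym.
rewrite [RHS](bigD1 a) // (bigD1 a' (P := fun b => (b \in _) && (b != a))) /=; last by rewrite aA' eq_sym.
rewrite !andbA; congr andb; last first.
  apply: eq_bigr => b /andP[/andP[+ nba] nba']; rewrite !inE => /andP[bY /eqP cb].
  by rewrite pblock_swap_other // ca.
rewrite pa pa'; have [ci|ci] := eqVneq i c0; last first.
  by rewrite !pblock_swap_fix ?imset_transpD // transp_neq // -?caa' ca eq_sym.
have xa : x = a.
  by case: (pblockP aY) => /rain rB aB; rewrite /x; apply: point_eq; rewrite ?ca.
have xa' : x' = a'.
  by case: (pblockP aY') => /rain rB aB; rewrite /x'; apply: point_eq; rewrite -?caa' ?ca.
have -> : pblock (swap P) a = transp P @: pblock P a'.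
  by rewrite -(pblock_swap aY') sE xa xa' tpermR.
have -> : pblock (swap P) a' = transp P @: pblock P a.
  by rewrite -(pblock_swap aY) sE xa xa' tpermL.
by rewrite !imset_transpD hC.
Qed.

End Swap.

(* Blocks are labelled by their point of colour [c0].  Letting [h] depend on the
   label makes room for a point of colour [c0] all of whose rainbow sets satisfy
   [f]; the last hypothesis is what the exchange of labels (i = c0) needs. *)
Lemma rainbow_even (f : pred {set T}) (c0 : I) (h : T -> I -> {set T} -> bool)
    (Y : {set T}) :
  (1 < #|I|)%N -> (#|I| < #|Y :&: hue c0|)%N ->
  (forall (a : T) (B : {set T}), rainbow B -> a \in B -> col a = c0 ->
     f B = \big[addb/false]_i h a i (B :\: hue i)) ->
  (forall a a' S S', h a c0 S && h a' c0 S' = h a c0 S' && h a' c0 S) ->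
  ~~ odd #|[set P in rainbow_partitions Y | [forall B in P, f B]]|.
Proof.
move=> I2 IY fE hC; rewrite odd_card.
(* Distributing the conjunction over the sums modulo 2 gives one term for each map [phi] from labels
   to colours. *)
have -> : \big[addb/false]_(P in rainbow_partitions Y) [forall B in P, f B] =
   \big[addb/false]_(P in rainbow_partitions Y) \big[addb/false]_(phi in pfamily c0 (mem (Y :&: hue c0)) (fun=> predT))
      \big[andb/true]_(a in Y :&: hue c0) h a (phi a) (pblock P a :\: hue (phi a)).
  apply: eq_bigr => P; rewrite inE => /andP[partP /forall_inP rP].
  have pbP a : a \in Y -> pblock P a \in P /\ a \in pblock P a.
    by rewrite -(cover_partition partP) => aY; rewrite pblock_mem // mem_pblock.
  transitivity (\big[andb/true]_(a in Y :&: hue c0) f (pblock P a)); last first.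
    rewrite -(@big_distr_big_dep _ _ _ _ _ _ _ c0 (mem (Y :&: hue c0)) (fun=> predT)
                (fun a i => h a i (pblock P a :\: hue i))).
    apply: eq_bigr => a; rewrite !inE => /andP[aY /eqP ca].
    by have [aP aB] := pbP a aY; rewrite (fE a) //; apply: rP.
  rewrite big_andE; apply/forall_inP/forall_inP => fP.
    by move=> a; rewrite inE => /andP[aY _]; apply: fP; case: (pbP a aY).
  move=> B BP; have [a aB ca] := rainbow_ex c0 (rP _ BP).
  rewrite -(def_pblock (partition_trivIset partP) BP aB).
  by apply: fP; rewrite !inE ca eqxx (subsetP (partitionS partP BP)).
rewrite exchange_big /= big1 // => phi _.
(* Pigeonhole: there are more labels than colours. *)
have [a [a' [aA aA' naa' ephi]]] : exists a a', [/\ a \in Y :&: hue c0, a' \in Y :&: hue c0, a != a' & phi a = phi a'].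
  have /dinjectivePn[a aA [a' /andP[naa' aA'] e]] : ~~ dinjectiveb phi (mem (Y :&: hue c0)).
    apply/negP => /dinjectiveP inj; move: IY; rewrite ltnNge => /negP; apply.
    by rewrite -(card_in_image inj) max_card.
  by exists a, a'; rewrite eq_sym.
have [aY ca] : a \in Y /\ col a = c0 by move: aA; rewrite !inE => /andP[? /eqP].
have [aY' ca'] : a' \in Y /\ col a' = c0 by move: aA'; rewrite !inE => /andP[? /eqP].
have caa' : col a = col a' by rewrite ca ca'.
apply: (addb_involution (s := swap (phi a) a a')) => P PY; split.
- exact: swap_rainbow_partition.
- exact: swapK aY aY' caa' PY.
- exact: swap_neq aY aY' naa' caa' PY I2.
- by apply: (swap_prod aY aY' naa' caa' PY) => // e S S'; rewrite e; apply: hC.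
Qed.
End Rainbow.

(** * Lower bounds for partitions into prescribed blocks *)

Section GoodPartitions.
Variables (T : finType) (f : pred {set T}).
Implicit Types (x : T) (B Y : {set T}) (P Q : {set {set T}}).

Definition good_partitions (Y : {set T}) : {set {set {set T}}} :=
  [set P | partition P Y & [forall B in P, f B]].

Definition occurs (Y B : {set T}) : bool :=
  [exists P in good_partitions Y, B \in P].

Lemma good_partitionsP Y P :
  reflect (partition P Y /\ forall B, B \in P -> f B) (P \in good_partitions Y).
Proof.
rewrite inE; apply: (iffP andP) => [[-> /forall_inP]|[-> fP]] //.
by split=> //; apply/forall_inP.
Qed.

Lemma good_partitions0 : #|good_partitions set0| = 1%N.
Proof.
apply/eqP/cards1P; exists set0; apply/setP => P; rewrite !inE partition_set0.
by have [->|//] := eqVneq P set0; apply/forall_inP => B; rewrite inE.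
Qed.

Lemma good_partitionsD1 Y P B :
  P \in good_partitions Y -> B \in P -> P :\ B \in good_partitions (Y :\: B).
Proof.
move=> /good_partitionsP[pP fP] BP; apply/good_partitionsP; split.
  exact: partitionD1.
by move=> C; rewrite !inE => /andP[_ /fP].
Qed.

Lemma good_partitionsU1 Y Q B : B \subset Y -> B != set0 -> f B ->
  Q \in good_partitions (Y :\: B) -> B |: Q \in good_partitions Y.
Proof.
move=> BY B0 fB /good_partitionsP[pQ fQ]; apply/good_partitionsP; split; last first.
  by move=> C; rewrite !inE => /orP[/eqP -> //|/fQ].
have -> : Y = B :|: (Y :\: B) by rewrite -{1}(setIidPr BY) setID.
by apply: partitionU1 => //; rewrite disjoint_sym disjoints_subset subsetDr.
Qed.

Lemma notin_good_partitionsD Y Q B : B != set0 ->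
  Q \in good_partitions (Y :\: B) -> B \notin Q.
Proof.
move=> B0 /good_partitionsP[pQ _]; apply: contraNN B0 => /(partitionS pQ).
by rewrite subsetD => /andP[_]; rewrite -setI_eq0 setIid.
Qed.

(** Double counting of pairs [B \in P]: adjoining [B] embeds the good partitions of [Y :\: B] into
    those of [Y] containing [B], and a partition has at most one block through [x]. *)
Lemma sum_good_partitionsD (x : T) (BB : {set {set T}}) (Y : {set T}) :
  (forall B, B \in BB -> [/\ x \in B, B \subset Y & f B]) ->
  \sum_(B in BB) #|good_partitions (Y :\: B)| <= #|good_partitions Y|.
Proof.
move=> BBP.
apply: (@leq_trans (\sum_(B in BB) \sum_(P in good_partitions Y) (B \in P))).
  apply: leq_sum => B /BBP[xB BY fB].
  have B0 : B != set0 by apply/set0Pn; exists x.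
  have injB : {in good_partitions (Y :\: B) &, injective (setU [set B])}.
    move=> Q Q' /(notin_good_partitionsD B0) BQ /(notin_good_partitionsD B0) BQ'.
    by move=> /(congr1 (fun Z => Z :\ B)); rewrite !setU1K.
  rewrite -(card_in_imset injB) -big_mkcondr /= sum1_card.
  apply: subset_leq_card; apply/subsetP => _ /imsetP[Q gQ ->].
  by rewrite unfold_in good_partitionsU1 //= setU11.
rewrite exchange_big /= -sum1_card; apply: leq_sum => P /good_partitionsP[pP _].
rewrite -big_mkcondr /= sum1_card; apply/card_le1_eqP => B B'.
rewrite !unfold_in => /andP[/BBP[xB _ _] BP] /andP[/BBP[xB' _ _] BP'].
have tP := partition_trivIset pP.
by rewrite -(def_pblock tP BP xB) -(def_pblock tP BP' xB').
Qed.

Lemma occursP Y B : reflect (exists2 P, P \in good_partitions Y & B \in P) (occurs Y B).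
Proof. exact: exists_inP. Qed.

Lemma occurs_sub Y B : occurs Y B -> B \subset Y /\ f B.
Proof.
move=> /occursP[P /good_partitionsP[pP fP] BP].
by split; [apply: partitionS pP BP|apply: fP].
Qed.

Lemma mul_good_partitions (x : T) (Y : {set T}) (c l : nat) :
  l <= #|[set B | occurs Y B & x \in B]| ->
  (forall B, occurs Y B -> c <= #|good_partitions (Y :\: B)|) ->
  l * c <= #|good_partitions Y|.
Proof.
move=> lx cB; apply: leq_trans (sum_good_partitionsD (x := x)
   (BB := [set B | occurs Y B & x \in B]) _); last first.
  by move=> B; rewrite inE => /andP[/occurs_sub[]].
apply: (@leq_trans (\sum_(B in [set B | occurs Y B & x \in B]) c)).
  by rewrite sum_nat_const leq_mul2r lx orbT.
by apply: leq_sum => B; rewrite inE => /andP[/cB].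
Qed.

(** A fixed point of [A] can be paired with any point of [A'], and each choice leaves a smaller
    instance. The remainder [W] lets the bound be applied to several families in succession. *)
Lemma fact_good_partitions (a : nat) (A A' W : {set T}) :
  #|A| = a -> #|A'| = a -> [disjoint A & A'] -> [disjoint A :|: A' & W] ->
  (forall x y, x \in A -> y \in A' -> f [set x; y]) ->
  a`! * #|good_partitions W| <= #|good_partitions (A :|: A' :|: W)|.
Proof.
elim: a A A' => [|a IHa] A A' cA cA' dA dW fA.
  by rewrite (cards0_eq cA) (cards0_eq cA') !set0U mul1n.
have /card_gt0P[x xA] : 0 < #|A| by rewrite cA.
have xA' : x \notin A' by rewrite (disjointFr dA).
have nA y : y \in A' -> y \notin A by move=> yA; rewrite (disjointFl dA).
have nW y : y \in A :|: A' -> y \notin W by move=> yA; rewrite (disjointFr dW).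
have inj : {in A' &, injective (fun y => [set x; y])}.
  move=> y y' yA' yA'' /setP/(_ y); rewrite !inE eqxx orbT => /esym/orP[]/eqP // e.
  by rewrite e (negbTE xA') in yA'.
apply: leq_trans (sum_good_partitionsD (x := x)
   (BB := [set [set x; y] | y in A']) _); last first.
  move=> _ /imsetP[y yA' ->]; split; first by rewrite !inE eqxx.
    by rewrite subUset !sub1set !inE xA yA' !orbT.
  exact: fA.
rewrite big_imset //= factS -mulnA -cA' -sum_nat_const; apply: leq_sum => y yA'.
have -> : (A :|: A' :|: W) :\: [set x; y] = (A :\ x) :|: (A' :\ y) :|: W.
  apply/setP => z; rewrite !inE.
  have [->|_] := eqVneq z x; first by rewrite (negbTE xA') andbF (negbTE (nW _ _)) // inE xA.
  have [->|_] := eqVneq z y; rewrite /= ?orbF //.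
  by rewrite (negbTE (nA _ yA')) (negbTE (nW _ _)) // inE yA' orbT.
apply: IHa.
- by apply/eqP; rewrite -eqSS -cA (cardsD1 x A) xA.
- by apply/eqP; rewrite -eqSS -cA' (cardsD1 y A') yA'.
- by apply: disjointW dA; apply: subsetDl.
- by apply: disjointWl dW; apply: setUSS; apply: subsetDl.
- by move=> u w; rewrite !inE => /andP[_ uA] /andP[_ wA]; apply: fA.
Qed.

Variable n : nat.
Hypothesis n_gt0 : 0 < n.
Hypothesis card_f : forall B, f B -> #|B| = n.

Lemma card_good_partition Y P : P \in good_partitions Y -> #|Y| = (#|P| * n)%N.
Proof.
move=> /good_partitionsP[pP fP].
by apply: card_uniform_partition pP => B /fP/card_f.
Qed.

Lemma eq_card_good_partition Y P P' :
  P \in good_partitions Y -> P' \in good_partitions Y -> #|P| = #|P'|.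
Proof.
move=> /card_good_partition + /card_good_partition => -> /eqP.
by rewrite eqn_pmul2r // => /eqP.
Qed.

Lemma good_partition_pblock Y P x : P \in good_partitions Y -> x \in Y ->
  pblock P x \in P /\ x \in pblock P x.
Proof.
by move=> /good_partitionsP[/cover_partition <- _] xY; rewrite pblock_mem // mem_pblock.
Qed.

Lemma good_partition_def Y P B x : P \in good_partitions Y -> B \in P -> x \in B ->
  pblock P x = B.
Proof. by move=> /good_partitionsP[/partition_trivIset tP _] BP xB; apply: def_pblock. Qed.

Lemma good_partitions_cover Y P Q : P \in good_partitions Y -> Q \subset P ->
  Q \in good_partitions (cover Q).
Proof.
move=> /good_partitionsP[pP fP] QP; apply/good_partitionsP; split; last first.
  by move=> B /(subsetP QP)/fP.
rewrite /partition eqxx (trivIsetS QP (partition_trivIset pP)) /=.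
by apply: contraFN (partition0 pP) => /(subsetP QP).
Qed.

Lemma good_partition_in Y P B x : P \in good_partitions Y -> B \in P -> x \in B -> x \in Y.
Proof.
move=> /good_partitionsP[pP _] BP; apply/subsetP; exact: partitionS pP BP.
Qed.

Lemma good_partitionsU Y P Q Q' : P \in good_partitions Y -> Q \subset P ->
  Q' \in good_partitions (cover Q) -> Q' :|: (P :\: Q) \in good_partitions Y.
Proof.
move=> gP QP gQ'; have /good_partitionsP[pP fP] := gP.
have /good_partitionsP[pQ' fQ'] := gQ'.
apply/good_partitionsP; split; last first.
  by move=> B; rewrite !inE => /orP[/fQ'|/andP[_ /fP]].
apply/and3P; split.
- rewrite /cover bigcup_setU -/(cover Q') -/(cover (P :\: Q)) (cover_partition pQ').
  by rewrite -(cover_partition pP) /cover -bigcup_setU -{1}(setIidPr QP) setID.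
- apply: trivIsetU; first exact: partition_trivIset pQ'.
    exact: trivIsetD (partition_trivIset pP).
  rewrite (cover_partition pQ') disjoint_subset; apply/subsetP => x.
  move=> /bigcupP[C CQ xC]; rewrite inE; apply/bigcupP => -[B + xB].
  rewrite inE => /andP[BQ BP]; case/negP: BQ.
  by rewrite -(good_partition_def gP BP xB) (good_partition_def gP (subsetP QP _ CQ) xC).
- by rewrite !inE (partition0 pP) (partition0 pQ') andbF.
Qed.

(** In the application [q] is [d.+2], and [alt] follows from the evenness of the count. *)
Variable q : nat.
Hypothesis alt : forall Y P, P \in good_partitions Y -> q <= #|P| ->
  exists2 P', P' \in good_partitions Y & P' != P.

(** Good partitions of [Y] have equally many blocks, so [P' != P] omits a block [B] of [P]; a point
    of [B] lies in [B] and in a different block of [P']. *)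
Lemma two_blocks Y P : P \in good_partitions Y -> q <= #|P| ->
  exists x, 2 <= #|[set B | occurs Y B & x \in B]|.
Proof.
move=> gP qP; have [P' gP' neP] := alt gP qP.
have /subsetPn[B BP BP'] : ~~ (P \subset P').
  apply: contra neP => sP; rewrite eq_sym eqEcard sP.
  by rewrite /= (eq_card_good_partition gP gP').
have [pP _] := good_partitionsP _ _ gP.
have /set0Pn[x xB] := partition_neq0 pP BP.
have xY := good_partition_in gP BP xB.
have [B'P' xB'] := good_partition_pblock gP' xY.
exists x; have BB' : B != pblock P' x by apply: contraNneq BP' => ->.
rewrite -[2](_ : #|[set B; pblock P' x]| = _); last by rewrite cards2 BB'.
apply: subset_leq_card; apply/subsetP => C; rewrite !inE => /orP[]/eqP ->.
  by rewrite xB andbT; apply/occursP; exists P.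
by rewrite xB' andbT; apply/occursP; exists P'.
Qed.

Lemma card_occursD Y P B m : P \in good_partitions Y -> #|P| = m.+1 ->
  occurs Y B -> exists2 Q, Q \in good_partitions (Y :\: B) & #|Q| = m.
Proof.
move=> gP cP /occursP[P' gP' BP']; exists (P' :\ B); first exact: good_partitionsD1.
apply/eqP; rewrite -eqSS -cP (eq_card_good_partition gP gP') (cardsD1 B P') BP'.
by [].
Qed.

(** While at least [q] blocks are present, some point has two possible blocks, and removing either
    gains a factor 2. The induction stops at [q.-1] blocks. *)
Lemma exp2_good_partitions m Y P : P \in good_partitions Y ->
  #|P| = (m + q.-1)%N -> 2 ^ m <= #|good_partitions Y|.
Proof.
elim: m Y P => [|m IHm] Y P gP cP.
  by rewrite expn0 card_gt0; apply/set0Pn; exists P.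
have [x x2] : exists x, 2 <= #|[set B | occurs Y B & x \in B]|.
  by apply: (two_blocks gP); lia.
rewrite expnS; apply: (mul_good_partitions x2) => B oB.
by have [Q gQ /(IHm _ _ gQ)] := card_occursD gP cP oB.
Qed.

(* If every point lies in at most one occurring block outside [P], then these
   blocks are pairwise disjoint, so the sets of blocks of [P] whose union is a
   union of such blocks ("full" sets) are stable under intersection. *)
Lemma three_blocks Y P : P \in good_partitions Y -> 2 * q - 1 <= #|P| ->
  exists x, 3 <= #|[set B | occurs Y B & x \in B]|.
Proof.
move=> gP qP.
have [/existsP[x x3]|] := boolP [exists x, 3 <= #|[set B | occurs Y B & x \in B]|].
  by exists x.
rewrite negb_exists => /forallP no3; exfalso.
(* The block of [P] through [x] is one occurrence already, which leaves room for only one other. *)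
have uniq_alt x e e' : occurs Y e -> occurs Y e' -> e \notin P -> e' \notin P ->
    x \in e -> x \in e' -> e = e'.
  move=> oe oe' eP eP' xe xe'; apply/eqP; apply: contraNT (no3 x) => nee'.
  have xY : x \in Y by have [/subsetP eY _] := occurs_sub oe; apply: eY.
  have [BP xB] := good_partition_pblock gP xY.
  have <- : #|pblock P x |: [set e; e']| = 3.
    rewrite cardsU1 cards2 nee' !inE negb_or.
    by rewrite (contraNneq _ eP) ?(contraNneq _ eP') // => <-.
  apply: subset_leq_card; apply/subsetP => C; rewrite !inE => /or3P[]/eqP -> //.
  - by rewrite xB andbT; apply/occursP; exists P.
  - by rewrite oe.
  - by rewrite oe'.
pose full (S : {set {set T}}) := [&& S != set0, S \subset P &
  [forall x in cover S, [exists e, [&& occurs Y e, e \notin P, x \in e & e \subset cover S]]]].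
have fullI S S' : full S -> full S' -> S :&: S' != set0 -> full (S :&: S').
  move=> /and3P[_ SP /forall_inP fS] /and3P[_ SP' /forall_inP fS'] n0.
  apply/and3P; split=> //; first by rewrite subIset // SP.
  apply/forall_inP => x /bigcupP[B /setIP[BS BS'] xB].
  have /fS/existsP[e /and4P[oe eP xe /subsetP eS]] : x \in cover S by apply/bigcupP; exists B.
  have /fS'/existsP[e' /and4P[oe' eP' xe' /subsetP eS']] : x \in cover S' by apply/bigcupP; exists B.
  apply/existsP; exists e; rewrite oe eP xe /=; apply/subsetP => y ye.
  have /bigcupP[C CS yC] := eS _ ye.
  have /bigcupP[C' CS' yC'] : y \in cover S'.
    by apply: eS'; rewrite -(uniq_alt x e e').
  apply/bigcupP; exists C => //; rewrite inE CS /=.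
  rewrite -(good_partition_def gP (subsetP SP _ CS) yC).
  by rewrite (good_partition_def gP (subsetP SP' _ CS') yC').
(* Good blocks all have [n] points, so an occurring block inside a block of [P] equals it. *)
have full1 B : ~~ full [set B].
  apply/negP => /and3P[_]; rewrite sub1set => BP /forall_inP fB.
  have /good_partitionsP[pP fP] := gP.
  have /set0Pn[x xB] := partition_neq0 pP BP.
  have cB : cover [set B] = B by rewrite /cover big_set1.
  have /fB/existsP[e /and4P[oe eP xe]] : x \in cover [set B] by rewrite cB.
  rewrite cB => eB; case/negP: eP; suff -> : e = B by [].
  apply/eqP; rewrite eqEcard eB; have [_ /card_f ->] := occurs_sub oe.
  by rewrite /= (card_f (fP _ BP)).
pose free Q := (Q \subset P) && [forall S : {set {set T}}, (S \subset Q) ==> ~~ full S].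
have freeP Q (S : {set {set T}}) : free Q -> S \subset Q -> ~~ full S.
  by move=> /andP[_ /forallP/(_ S)/implyP].
have free0 : free set0.
  rewrite /free sub0set; apply/forallP => S; apply/implyP.
  by rewrite subset0 => /eqP ->; rewrite /full eqxx.
(* Take a maximal subfamily [Q] of [P] containing no full set. It will have at least half of the
   blocks, hence at least [q], and an alternative partition of its points will exhibit a full
   set. *)
have [Q /maxsetP[fQ maxQ] _] := maxset_exists free0.
have QP : Q \subset P by case/andP: fQ.
(* By maximality [B] completes a full set within [B |: Q]; a full set is not a single block, so it
   also contains some [c] of [Q]. *)
have linkP B : B \in P :\: Q -> exists c, [&& c \in Q &
    [exists S, [&& full S, S \subset B |: Q & c \in S]]].
  rewrite inE => /andP[BQ BP].
  have : ~~ free (B |: Q).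
    apply: contraNN BQ => /maxQ/(_ (subsetUr _ _)) <-; exact: setU11.
  rewrite /free subUset sub1set BP QP /= negb_forall => /existsP[S].
  rewrite negb_imply negbK => /andP[SBQ fS].
  have /subsetPn[c cS cB] : ~~ (S \subset [set B]).
    apply: contraTN fS; rewrite subset1 => /orP[]/eqP -> //.
    by rewrite /full eqxx.
  exists c; rewrite inE in cB; have := subsetP SBQ _ cS; rewrite !inE (negbTE cB) /= => ->.
  by apply/existsP; exists S; rewrite fS SBQ.
pose link B := odflt B [pick c | [&& c \in Q &
    [exists S, [&& full S, S \subset B |: Q & c \in S]]]].
have linkE B : B \in P :\: Q -> link B \in Q /\
    exists S, [/\ full S, S \subset B |: Q & link B \in S].
  rewrite /link => /linkP[c cP]; case: pickP => [b /andP[bQ /existsP[S /and3P[? ? ?]]]|/(_ c)].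
    by split=> //; exists S.
  by rewrite cP.
(* Two blocks linked to the same [c] would have full sets meeting in a full subset of [Q]. *)
have link_inj : {in P :\: Q &, injective link}.
  move=> B B' BPQ BPQ' ebb'; apply/eqP; apply: contraT => nBB'.
  have [_ [S [fS SB bS]]] := linkE _ BPQ.
  have [_ [S' [fS' SB' bS']]] := linkE _ BPQ'.
  have n0 : S :&: S' != set0.
    by apply/set0Pn; exists (link B); rewrite inE bS ebb' bS'.
  suff SSQ : S :&: S' \subset Q.
    by have := freeP _ _ fQ SSQ; rewrite fullI.
  apply/subsetP => c; rewrite inE => /andP[/(subsetP SB) + /(subsetP SB')].
  rewrite !inE => /orP[/eqP ->|//] /orP[|//]; by rewrite (negbTE nBB').
have cPQ : #|P :\: Q| <= #|Q|.
  rewrite -(card_in_imset link_inj); apply: subset_leq_card.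
  by apply/subsetP => _ /imsetP[B /linkE[bQ _] ->].
have qQ : q <= #|Q|.
  by have := cardsID Q P; rewrite (setIidPr QP); lia.
have gQ := good_partitions_cover gP QP.
have [Q' gQ' neQ] := alt gQ qQ.
(* The blocks of [Q] missing from [Q'] form a full set: their points are covered again by blocks of
   [Q'] outside [P], and these stay inside their union. *)
have : ~~ full (Q :\: Q') by apply: freeP fQ _; apply: subsetDl.
case/negP; apply/and3P; split.
- apply: contra neQ; rewrite setD_eq0 => sQ; rewrite eq_sym eqEcard sQ.
  by rewrite /= (eq_card_good_partition gQ gQ').
- by rewrite (subset_trans _ QP) // subsetDl.
apply/forall_inP => x /bigcupP[B]; rewrite inE => /andP[BQ' BQ] xB.
have xQ : x \in cover Q by apply/bigcupP; exists B.
have [eQ' xe] := good_partition_pblock gQ' xQ.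
have eP : pblock Q' x \notin P.
  apply: contra BQ' => eP.
  by rewrite -(good_partition_def gP (subsetP QP _ BQ) xB) (good_partition_def gP eP xe).
apply/existsP; exists (pblock Q' x); rewrite eP xe /= andbC; apply/andP; split.
  apply/subsetP => y ye.
  have /bigcupP[C CQ yC] := good_partition_in gQ' eQ' ye.
  apply/bigcupP; exists C => //; rewrite inE CQ andbT.
  apply: contra eP => CQ'.
  by rewrite -(good_partition_def gQ' eQ' ye) (good_partition_def gQ' CQ' yC) (subsetP QP).
by apply/occursP; exists (Q' :|: (P :\: Q)); [apply: (good_partitionsU gP)|rewrite inE eQ'].
Qed.

(** The first [m] removals gain a factor 3 each; once [2 * q.-1] blocks remain, the factor 2 takes
    over. *)
Lemma exp3_good_partitions m Y P : P \in good_partitions Y ->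
  #|P| = (m + 2 * q.-1)%N -> 2 ^ q.-1 * 3 ^ m <= #|good_partitions Y|.
Proof.
elim: m Y P => [|m IHm] Y P gP cP.
  by rewrite muln1; apply: (exp2_good_partitions gP); lia.
have [x x3] : exists x, 3 <= #|[set B | occurs Y B & x \in B]|.
  by apply: (three_blocks gP); lia.
rewrite expnS mulnCA; apply: (mul_good_partitions x3) => B oB.
by have [Q gQ /(IHm _ _ gQ)] := card_occursD gP cP oB.
Qed.

End GoodPartitions.

(** * Convex hulls, cones and general position *)

Local Open Scope ring_scope.

(** In characteristic 0 the numbers [0, ..., size q - 1] are distinct, and they are more than [q]
    has roots. *)
Lemma poly_nonroot (R : numDomainType) (q : {poly R}) : q != 0 -> exists t, q.[t] != 0.
Proof.
move=> q0; pose rs : seq R := [seq i%:R | i <- iota 0 (size q)].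
have [/hasP[t _ qt]|/hasPn rsq] := boolP (has (fun t => ~~ root q t) rs).
  by exists t.
have /(max_poly_roots q0) : all (root q) rs by apply/allP => t /rsq; rewrite negbK.
rewrite map_inj_uniq ?iota_uniq => [/(_ isT)|]; first by rewrite size_map size_iota ltnn.
by move=> i j /eqP; rewrite eqr_nat => /eqP.
Qed.

Section Combinations.
Variables (R : realFieldType) (d : nat) (T : finType) (v : T -> 'rV[R]_d).
Implicit Types (S B : {set T}) (w : T -> R) (r : 'rV[R]_d).

Definition comb S w : 'rV[R]_d := \sum_(x in S) w x *: v x.

Definition indep S := forall w, comb S w = 0 -> forall x, x \in S -> w x = 0.

Definition rows S : 'M[R]_(#|S|, d) := \matrix_(i < #|S|) v (enum_val i).

Lemma comb_rows S w : comb S w = (\row_i w (enum_val i)) *m rows S.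
Proof.
rewrite mulmx_sum_row /comb big_enum_val /=; apply: eq_bigr => i _.
by rewrite mxE rowK.
Qed.

Lemma rows_comb S (u : 'rV[R]_#|S|) : exists w,
  (forall i, w (enum_val i) = u 0 i) /\ comb S w = u *m rows S.
Proof.
pose w x := \sum_(i | enum_val i == x) u 0 i.
have wE i : w (enum_val i) = u 0 i.
  rewrite /w (big_pred1 i) // => j; exact: (inj_eq enum_val_inj).
by exists w; split=> //; rewrite comb_rows; congr (_ *m _); apply/rowP => i; rewrite mxE.
Qed.

Lemma comb_dep S : (d < #|S|)%N ->
  exists w, comb S w = 0 /\ exists2 x, x \in S & w x != 0.
Proof.
move=> dS; have kn0 : kermx (rows S) != 0.
  rewrite -mxrank_eq0 mxrank_ker subn_eq0 -ltnNge.
  exact: leq_ltn_trans (rank_leq_col _) dS.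
have /rowV0Pn[u /sub_kermxP uM u0] := kn0.
have [w [wE wM]] := rows_comb u; exists w; split; first by rewrite wM.
have /rV0Pn[i ui] := u0; exists (enum_val i); last by rewrite wE.
exact: enum_valP.
Qed.

Lemma comb_span S r : #|S| = d -> indep S -> exists w, comb S w = r.
Proof.
move=> Sd iS; have free : row_free (rows S).
  rewrite -kermx_eq0; apply: contraT => /rowV0Pn[u /sub_kermxP uM u0].
  have [w [wE wM]] := rows_comb u; have /rV0Pn[i] := u0.
  by rewrite -wE (iS w) ?eqxx ?wM //; apply: enum_valP.
have full : row_full (rows S) by rewrite /row_full -[X in _ == X]Sd.
have /submxP[u ->] := submx_full r full.
by have [w [_ wM]] := rows_comb u; exists w.
Qed.

Lemma normal_ex S : (\rank (rows S) < d)%N ->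
  exists u : 'cV[R]_d, (u != 0) && [forall x in S, v x *m u == 0].
Proof.
rewrite ltnNge -subn_eq0 -mxrank_coker mxrank_eq0.
move=> /matrix0Pn[i [j uij]]; exists (col j (cokermx (rows S))); apply/andP; split.
  by apply/cV0Pn; exists i; rewrite mxE.
apply/forall_inP => x xS; rewrite -(enum_rankK_in xS xS).
have -> : v (enum_val (enum_rank_in xS x)) = row (enum_rank_in xS x) (rows S).
  by rewrite rowK.
by rewrite colE mulmxA -row_mul mulmx_coker row0 mul0mx.
Qed.

(** Fewer than [d] vectors have a common nonzero normal. Along the moment curve [(1, t, t ^ 2, ...)]
    the pairing with a normal is a nonzero polynomial in [t], and some [t] avoids the roots of all
    these polynomials. *)
Lemma generic_direction : exists r, forall S w, (#|S| < d)%N -> comb S w != r.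
Proof.
have normal S : (#|S| < d)%N -> exists u : 'cV[R]_d, (u != 0) && [forall x in S, v x *m u == 0].
  by move=> Sd; apply: normal_ex; apply: leq_ltn_trans (rank_leq_row _) Sd.
(* A total choice of normals: [0] is a dummy value for sets of [d] or more points. *)
pose u S := if insub S : {? S : {set T} | (#|S| < d)%N} is Some s
  then xchoose (normal _ (valP s)) else 0.
have uP S : (#|S| < d)%N -> u S != 0 /\ forall x, x \in S -> v x *m u S = 0.
  move=> Sd; rewrite /u insubT /=.
  have /andP[-> /forall_inP uS] := xchooseP (normal _ (valP (Sub S Sd : {S : {set T} | (#|S| < d)%N}))).
  by split=> // x xS; apply/eqP/uS.
pose q := \prod_(S : {set T} | (#|S| < d)%N) rVpoly (u S)^T.
have : q != 0.
  apply/prodf_neq0 => S /uP[u0 _]; apply: contraNneq u0 => e.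
  apply/eqP/trmx_inj/(can_inj rVpolyK); rewrite e trmx0.
  by rewrite linear0.
move=> /poly_nonroot[t qt]; exists (\row_i t ^+ i) => S w Sd.
move: qt; rewrite horner_prod => /prodf_neq0/(_ S Sd); apply: contraNneq => e.
have [_ uS] := uP S Sd.
have : comb S w *m u S = 0.
  rewrite mulmx_suml big1 // => x xS; by rewrite -scalemxAl uS // scaler0.
rewrite e => /matrixP/(_ 0 0); rewrite !mxE => e0.
rewrite (@horner_coef_wide _ d) ?size_poly // -[X in _ == X]e0.
apply/eqP/eq_bigr => i _; rewrite coef_rVpoly_ord !mxE mulrC.
by [].
Qed.

Lemma combD S w w' (l : R) : comb S (fun x => w x + l * w' x) = comb S w + l *: comb S w'.
Proof.
rewrite /comb scaler_sumr -big_split /=; apply: eq_bigr => x _.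
by rewrite scalerDl scalerA.
Qed.

Lemma comb_D1 S w x : x \in S -> w x = 0 -> comb S w = comb (S :\ x) w.
Proof. by move=> xS w0; rewrite /comb (big_setD1 x) //= w0 scale0r add0r. Qed.

Lemma eq_comb S w w' : {in S, w =1 w'} -> comb S w = comb S w'.
Proof. by move=> e; apply: eq_bigr => x xS; rewrite e. Qed.

Lemma indep_eq S w w' : indep S -> comb S w = comb S w' -> {in S, w =1 w'}.
Proof.
move=> iS e x xS; apply/eqP; rewrite -subr_eq0; apply/eqP.
rewrite -[w' x]mul1r -mulNr; apply: (iS (fun x => w x + -1 * w' x)) => //.
by rewrite combD e scaleN1r subrr.
Qed.

Definition in_cone S r : Prop := exists w, (forall x, x \in S -> 0 <= w x) /\ comb S w = r.

End Combinations.

(* In the order given by [t], the index [i] is counted when, apart from [i], all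
   negative [c] come before it and all positive ones after it; for a sequence of
   signs -...-+...+ with both signs present there are exactly two such [i]. *)
Lemma odd_card_sign_cut (R : realFieldType) (T : finType) (B : {set T}) (c t : T -> R) :
  (0 < #|B|)%N -> {in B &, injective t} -> {in B, forall j, c j != 0} ->
  odd #|[set i in B | [forall j in B, 0 <= c j * (t j - t i)]]| =
  [forall j in B, 0 < c j] || [forall j in B, c j < 0].
Proof.
move=> B0 tinj c0; set V := [set i in B | _].
pose N := [set j in B | c j < 0]; pose Q := [set j in B | 0 < c j].
have VP i : i \in B -> (i \in V) =
    [forall j in N, t j <= t i] && [forall j in Q, t i <= t j].
  move=> iB; rewrite inE iB /=; apply/forall_inP/andP => [iV|[/forall_inP iN /forall_inP iQ] j jB].
    split; apply/forall_inP => j; rewrite inE => /andP[jB cj].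
      by have := iV j jB; rewrite nmulr_rge0 // subr_le0.
    by have := iV j jB; rewrite pmulr_rge0 // subr_ge0.
  have := c0 j jB; rewrite neq_lt => /orP[cj|cj].
    by rewrite nmulr_rge0 // subr_le0 iN // inE jB.
  by rewrite pmulr_rge0 // subr_ge0 iQ // inE jB.
have VB i : i \in V -> i \in B by rewrite inE => /andP[].
have NQ i : i \in B -> (i \in N) || (i \in Q).
  by move=> iB; rewrite !inE iB /= -neq_lt c0.
have [N0|/set0Pn[n0 n0N]] := eqVneq N set0.
  have allQ i : i \in B -> i \in Q by move=> /NQ; rewrite N0 inE.
  have -> : [forall j in B, 0 < c j].
    by apply/forall_inP => j /allQ; rewrite inE => /andP[].
  have /card_gt0P[x0 x0B] := B0.
  case: (arg_minP t x0B) => m mB mmin.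
  suff -> : V = [set m] by rewrite cards1.
  apply/setP => i; rewrite inE; apply/idP/eqP => [iV|->].
    have iB := VB _ iV; move: iV; rewrite VP // => /andP[_ /forall_inP/(_ _ (allQ _ mB)) tim].
    by apply: tinj => //; apply/eqP; rewrite eq_le tim mmin.
  rewrite VP // N0; apply/andP; split; apply/forall_inP => j; rewrite inE // => /andP[jB _].
  exact: mmin.
have [Q0|/set0Pn[q0 q0Q]] := eqVneq Q set0.
  have allN i : i \in B -> i \in N by move=> /NQ; rewrite Q0 in_set0 orbF.
  have -> : [forall j in B, c j < 0].
    by apply/forall_inP => j /allN; rewrite inE => /andP[].
  have /card_gt0P[x0 x0B] := B0.
  case: (arg_maxP t x0B) => m mB max.
  have mmax j : j \in B -> t j <= t m := max j.
  rewrite orbT; suff -> : V = [set m] by rewrite cards1.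
  apply/setP => i; rewrite inE; apply/idP/eqP => [iV|->].
    have iB := VB _ iV; move: iV; rewrite VP // => /andP[/forall_inP/(_ _ (allN _ mB)) tim _].
    by apply: tinj => //; apply/eqP; rewrite eq_le tim mmax.
  rewrite VP // Q0; apply/andP; split; apply/forall_inP => j; rewrite inE // => /andP[jB _].
  exact: mmax.
have -> : [forall j in B, 0 < c j] = false.
  apply/negP => /forall_inP/(_ n0); move: n0N; rewrite inE => /andP[nB cn] /(_ nB).
  by rewrite ltNge ltW.
have -> : [forall j in B, c j < 0] = false.
  apply/negP => /forall_inP/(_ q0); move: q0Q; rewrite inE => /andP[qB cq] /(_ qB).
  by rewrite ltNge ltW.
case: (arg_maxP t n0N) => n nN' max; have nN : n \in N := nN'.
have nmax j : j \in N -> t j <= t n := max j.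
case: (arg_minP t q0Q) => m mQ' mmin; have mQ : m \in Q := mQ'.
have nB : n \in B by move: nN; rewrite inE => /andP[].
have mB : m \in B by move: mQ; rewrite inE => /andP[].
have [tnm|tmn] := leP (t n) (t m); last first.
  rewrite (_ : V = set0) ?cards0 //; apply/setP => i; rewrite [RHS]inE.
  apply/negP => iV; have iB := VB _ iV; move: iV; rewrite VP // => /andP[/forall_inP iN /forall_inP iQ].
  by have := lt_le_trans tmn (iN _ nN); rewrite ltNge iQ.
have nm : n != m.
  apply: contraTneq nN => ->; move: mQ; rewrite !inE => /andP[-> cm].
  by rewrite ltNge ltW.
rewrite (_ : V = [set n; m]) ?cards2 ?nm //; apply/setP => i; rewrite !(in_set1, in_setU).
apply/idP/orP => [iV|[]/eqP ->].
- have iB := VB _ iV; move: iV; rewrite VP // => /andP[/forall_inP iN /forall_inP iQ].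
  have /orP[iN'|iQ'] := NQ _ iB; [left|right]; apply/eqP/tinj => //; apply/eqP; rewrite eq_le.
    by rewrite nmax // iN.
  by rewrite mmin // iQ.
- rewrite VP //; apply/andP; split; apply/forall_inP => j jX; first exact: nmax.
  exact: le_trans tnm (mmin _ jX).
- rewrite VP //; apply/andP; split; apply/forall_inP => j jX; last exact: mmin.
  exact: le_trans (nmax _ jX) tnm.
Qed.

(** Up to scaling, the [d.+1] vectors satisfy one relation [c], with no zero coefficient, and [p] is
    in the hull iff all [c y] have the same sign. The representations of [r] form a line [a - t c];
    the one vanishing at [i] is nonnegative iff [c j * (t j - t i) >= 0] for all [j]. Counting such
    [i] is counting sign cuts. *)
Lemma conv_cone_parity (R : realType) (d : nat) (T : finType) (x : T -> 'rV[R]_d)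
    (p r : 'rV[R]_d) (B : {set T}) :
  let v y := x y - p in
  #|B| = d.+1 -> (forall y, y \in B -> indep v (B :\ y)) ->
  (forall (S : {set T}) w, (#|S| < d)%N -> comb v S w != r) ->
  `[< in_conv x B p >] = odd #|[set y in B | `[< in_cone v (B :\ y) r >]]|.
Proof.
move=> v cB iB gr.
have [c [c0 [z zB cz]]] : exists c, comb v B c = 0 /\ exists2 y, y \in B & c y != 0.
  by apply: comb_dep; rewrite cB.
have cn0 : {in B, forall y, c y != 0}.
  move=> y yB; apply: contraNneq cz => cy.
  have [<-|nyz] := eqVneq y z; first by rewrite cy.
  rewrite (iB y yB c) //; first by rewrite -(comb_D1 _ yB).
  by rewrite !inE eq_sym nyz.
have [a ar] : exists a, comb v B a = r.
  have Bz : #|B :\ z| = d by apply/eqP; rewrite -eqSS -cB (cardsD1 z B) zB.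
  have [a ar] := comb_span r Bz (iB z zB).
  exists (fun y => if y == z then 0 else a y); rewrite (comb_D1 _ zB) ?eqxx // -ar.
  by apply: eq_comb => y; rewrite !inE => /andP[/negbTE ->].
pose t y := a y / c y.
have aE y : y \in B -> a y = t y * c y by move=> /cn0 cy; rewrite /t divfK.
(* [e i] is the representation of [r] whose coefficient at [i] vanishes. *)
pose e i y := a y + - t i * c y.
have er i : comb v B (e i) = r by rewrite /e combD c0 scaler0 addr0.
have e0 i : i \in B -> e i i = 0 by move=> iB'; rewrite /e aE // mulNr subrr.
(* Equal parameters would write [r] with fewer than [d] vectors, against its genericity. *)
have tinj : {in B &, injective t}.
  move=> i j iB' jB tij; apply/eqP; apply: contraT => nij.
  have jBi : j \in B :\ i by rewrite !inE eq_sym nij.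
  have eij : e i j = 0 by rewrite /e tij; apply: e0.
  have lt_d : (#|(B :\ i) :\ j| < d)%N.
    by have := cardsD1 i B; have := cardsD1 j (B :\ i); rewrite jBi iB' cB; lia.
  by have := gr _ (e i) lt_d; rewrite -(comb_D1 _ jBi eij) -(comb_D1 _ iB' (e0 _ iB')) er eqxx.
have -> : [set y in B | `[< in_cone v (B :\ y) r >]] =
    [set i in B | [forall j in B, 0 <= c j * (t j - t i)]].
  apply/setP => i; rewrite !inE; apply: andb_id2l => iB'.
  have cE j : j \in B -> c j * (t j - t i) = e i j.
    by move=> jB; rewrite /e aE // mulrC mulrBl mulNr.
  apply/asboolP/forall_inP => [[w [w0 wr]] j jB|ipos].
    rewrite cE //; have [->|nji] := eqVneq j i; first by rewrite e0.
    have jBi : j \in B :\ i by rewrite !inE nji.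
    rewrite -(indep_eq (iB i iB') (w := w)) ?w0 //.
    by rewrite wr -(comb_D1 _ iB' (e0 _ iB')).
  exists (e i); split; last by rewrite -(comb_D1 _ iB' (e0 _ iB')).
  by move=> j; rewrite inE => /andP[_ jB]; rewrite -cE ?ipos.
rewrite odd_card_sign_cut ?cB //.
have combE w : comb v B w = \sum_(y in B) w y *: x y - (\sum_(y in B) w y) *: p.
  rewrite scaler_suml -sumrB; apply: eq_bigr => y _; exact: scalerBr.
apply/asboolP/idP => [[w [w0 w1 wp]]|cs].
  have wv : comb v B w = 0 by rewrite combE -wp w1 scale1r subrr.
  (* Subtracting the multiple of [c] that agrees with [w] at [z] leaves a relation on [B :\ z],
     which is trivial. *)
  pose l := w z / c z.
  have wE : {in B, w =1 (fun y => l * c y)}.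
    move=> y yB; have [->|nyz] := eqVneq y z; first by rewrite /l divfK.
    have wlz : w z + - l * c z = 0 by rewrite mulNr /l divfK // subrr.
    have yBz : y \in B :\ z by rewrite !inE nyz.
    apply/eqP; rewrite -subr_eq0 -mulNr.
    rewrite (iB z zB (fun u => w u + - l * c u)) // -comb_D1 //.
    by rewrite combD wv c0 scaler0 addr0.
  have l0 : l != 0.
    apply: contra_eq_neq w1 => l0; rewrite big1 ?(eq_sym 0) ?oner_eq0 //.
    by move=> y /wE ->; rewrite l0 mul0r.
  move: l0; rewrite neq_lt => /orP[l0|l0]; apply/orP; [right|left]; apply/forall_inP => y yB.
    by have := w0 y yB; rewrite wE // nmulr_rge0 // => cy; rewrite lt_neqAle cn0.
  by have := w0 y yB; rewrite wE // pmulr_rge0 // => cy; rewrite lt_neqAle eq_sym cn0.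
(* All [c y] have the sign of their sum [s], so the [c y / s] are convex weights. *)
pose s := \sum_(y in B) c y.
have [s0 sc] : s != 0 /\ {in B, forall y, 0 <= c y / s}.
  case/orP: cs => /forall_inP cs.
    have s0 : 0 < s.
      rewrite /s (big_setD1 z) //=; apply: ltr_pwDl; first exact: cs.
      by apply: sumr_ge0 => y; rewrite inE => /andP[_ /cs/ltW].
    by split=> [|y yB]; [rewrite gt_eqF|rewrite divr_ge0 ?ltW ?cs].
  have s0 : s < 0.
    rewrite /s (big_setD1 z) //= -[X in _ < X](addr0 0); apply: ltr_leD; first exact: cs.
    by apply: sumr_le0 => y; rewrite inE => /andP[_ /cs/ltW].
  split=> [|y yB]; first by rewrite lt_eqF.
  by rewrite -mulrNN -invrN divr_ge0 // oppr_ge0 ltW ?cs.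
exists (fun y => c y / s); split=> //; first by rewrite -mulr_suml divff.
apply/eqP; rewrite eq_sym -subr_eq0 -[X in _ - X]scale1r -(divff s0) mulr_suml -combE.
under [comb _ _ _]eq_comb => y _ do rewrite mulrC.
rewrite /comb; under eq_bigr => y _ do rewrite -scalerA.
by rewrite -scaler_sumr -[X in _ *: X]/(comb v B c) c0 scaler0.
Qed.

(** A dependence would put the [d] differences in a linear hyperplane; its translate by [p] contains
    [p] and the [d] points of [S], too many for an affine subspace of dimension [d - 1]. *)
Lemma general_position_indep (R : realType) (d : nat) (p : 'rV[R]_d)
    (X : {fset 'rV[R]_d}) (S : {set X}) :
  (0 < d)%N -> general_position (p |` X)%fset -> #|S| = d ->
  {in S, forall x, val x != p} -> indep (fun x : X => val x - p) S.
Proof.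
move=> d0 gX Sd Sp w w0 x xS; apply/eqP; apply: contraT => wx; exfalso.
set v := fun x : X => val x - p in w0.
have rk : (\rank (rows v S) < d)%N.
  rewrite ltn_neqAle rank_leq_col andbT.
  apply: contra wx => rkd; have free : row_free (rows v S) by rewrite /row_free (eqP rkd) Sd.
  move: w0; rewrite comb_rows => /eqP; rewrite mulmx_free_eq0 //.
  move=> /eqP/rowP/(_ (enum_rank_in xS x)).
  by rewrite !mxE enum_rankK_in // => ->.
have [u /andP[u0 /forall_inP uS]] := normal_ex rk.
pose F := linfun (mulmxr u : 'rV[R]_d -> 'M[R]_1).
(* Rank-nullity: a nonzero functional has rank 1. *)
have dimF : (\dim (lker F) = d.-1)%VS.
  have := limg_ker_dim F fullv; rewrite capfv dimvf /dim /= mul1n.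
  suff -> : (\dim (F @: fullv) = 1)%VS by lia.
  apply/eqP; rewrite eqn_leq; apply/andP; split.
    by apply: leq_trans (dimvS (subvf _)) _; rewrite dimvf /dim /= muln1.
  rewrite lt0n dimv_eq0; apply: contra u0 => /eqP F0.
  apply/eqP/row_matrixP => i; rewrite row0 rowE.
  have : F (delta_mx 0 i) \in (F @: fullv)%VS by rewrite memv_img ?memvf.
  by rewrite F0 memv0 lfunE /= => /eqP.
pose A : {fset 'rV[R]_d} := (p |` [fset y in [seq val z | z <- enum S]])%fset.
have := @gX d.-1 p (lker F) A; case.
- by rewrite prednK.
- exact: dimF.
- apply: fsetUS; apply/fsubsetP => y; rewrite inE /= => /mapP[z _ ->]; exact: valP.
- rewrite cardfsU1 card_fseq undup_id; last by rewrite map_inj_uniq ?enum_uniq //; apply: val_inj.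
  rewrite size_map -cardE Sd inE /= (_ : p \notin _) ?prednK //.
  by apply/mapP => -[z]; rewrite mem_enum => /Sp /eqP + /esym.
- move=> y; rewrite !inE /= => /orP[/eqP ->|/mapP[z]].
    by rewrite subrr mem0v.
  by rewrite mem_enum => zS ->; rewrite memv_ker lfunE /= uS.
Qed.

(** * Colored Birch partitions *)

Section ColoredBirch.
Variables (R : realType) (d : nat) (p : 'rV[R]_d) (X : {fset 'rV[R]_d}).
Variable (col : X -> 'I_d.+1).

Local Notation birch := (birch_block p col).

Lemma birch_blockE (B : {set X}) :
  birch B = rainbow col B && `[< in_conv (fun x : X => val x) B p >].
Proof.
rewrite /birch_block andbA; congr andb; apply/andP/idP => [[_ //]|rB].
by split=> //; rewrite (card_rainbow rB) card_ord.
Qed.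

Lemma card_birch_block (B : {set X}) : birch B -> #|B| = d.+1.
Proof. by move=> /and3P[/eqP]. Qed.

Lemma birch_partitionsE (Y : {set X}) : good_partitions birch Y =
  [set P in rainbow_partitions col Y |
     [forall B in P, `[< in_conv (fun x : X => val x) B p >] ] ].
Proof.
apply/setP => P; rewrite !inE -andbA; congr andb.
apply/forall_inP/andP => [bP|[/forall_inP rP /forall_inP cP] B BP].
  by split; apply/forall_inP => B /bP; rewrite birch_blockE => /andP[].
by rewrite birch_blockE rP // cP.
Qed.

Lemma card_birch_hue (Y : {set X}) (P : {set {set X}}) (i : 'I_d.+1) :
  P \in good_partitions birch Y -> #|Y :&: hue col i| = #|P|.
Proof.
rewrite birch_partitionsE inE => /andP[rP _].
have := card_hue_pblock predT i rP.
rewrite (_ : [set x in _ | _] = Y :&: hue col i); last first.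
  by apply/setP => x; rewrite !inE andbT.
by move=> ->; apply: eq_card => B; rewrite inE andbT.
Qed.

(** Blocks have [d.+1] points, so a partition of [k * d.+1] points into them has exactly [k]
    blocks. *)
Lemma cBPE (k : nat) : #|` X| = (k * d.+1)%N ->
  cBP p col k = #|good_partitions birch [set: X]|.
Proof.
move=> cX; apply: eq_card => P; rewrite !inE /colored_birch_partition.
apply: andb_id2l => pP; case: (boolP [forall B in P, birch B]) => [bP|]; rewrite ?andbF //.
have /(card_good_partition card_birch_block) : P \in good_partitions birch [set: X] by rewrite inE pP.
by rewrite cardsT -cardfE cX andbT => /eqP; rewrite eqn_pmul2r // eq_sym.
Qed.

Hypotheses (d_gt0 : (0 < d)%N) (genX : general_position (p |` X)%fset).

(* The hypotheses allow [p] to belong to [X]; every rainbow set containing it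
   then has [p] in its convex hull and the cone decomposition fails.  In that
   case the colour of [p] is the one used for labelling the blocks. *)
Lemma birch_even (Y : {set X}) :
  (forall i, d.+1 < #|Y :&: hue col i|)%N -> ~~ odd #|good_partitions birch Y|.
Proof.
move=> dY; rewrite birch_partitionsE.
have [r r_gen] := generic_direction (fun x : X => val x - p).
have [c0 c0P] : exists c0, forall z : X, val z = p -> col z = c0.
  (* [c0] is the colour of [p] if [p] is a point of [X], and an arbitrary colour otherwise. *)
  have [pX|pX] := boolP (p \in X).
    by exists (col [` pX]%fset) => z zp; congr col; apply: val_inj.
  by exists ord0 => z zp; rewrite -zp (valP z) in pX.
have [c1 c10] : exists c1, c1 != c0.
  have : (0 < #|predC1 c0|)%N by rewrite cardC1 card_ord.
  by case/card_gt0P => c1; exists c1.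
(* At the label [p] the sum over colours must be true, so exactly one colour [c1] contributes;
   [c1 != c0] makes both sides of the exchange condition false there. *)
pose h (a : X) (i : 'I_d.+1) (S : {set X}) : bool :=
  if val a == p then i == c1 else `[< in_cone (fun x : X => val x - p) S r >].
apply: (rainbow_even (c0 := c0) (h := h)).
- by rewrite card_ord.
- by rewrite card_ord dY.
- move=> a B rB aB ca; rewrite /h; have [ap|ap] := eqVneq (val a) p.
    rewrite (bigD1 c1) //= eqxx big1 => [|i /negbTE //].
    apply/asboolP; exists (fun x => (x == a)%:R); split.
    + by move=> i _; rewrite ler0n.
    + rewrite (big_setD1 a) //= eqxx big1 ?addr0 // => x.
      by rewrite !inE => /andP[/negbTE ->].
    + rewrite (big_setD1 a) //= eqxx scale1r ap big1 ?addr0 // => x.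
      by rewrite !inE => /andP[/negbTE ->]; rewrite scale0r.
  have cB : #|B| = d.+1 by rewrite (card_rainbow rB) card_ord.
  (* The label is the only point of colour [c0] in [B], and it is not [p]. *)
  have Bp x : x \in B -> val x != p.
    move=> xB; apply: contraNneq ap => xp; rewrite -xp.
    by apply/eqP; congr val; apply: (rainbow_inj rB) => //; rewrite ca (c0P x).
  rewrite (conv_cone_parity (r := r) cB); last exact: r_gen.
    (* In a rainbow set, removing a point is removing its colour, so the count over points becomes a
       sum over colours. *)
    rewrite odd_card [RHS](reindex_onto col (point col a B)) /=; last first.
      by move=> i _; have [] := pointP a i rB.
    apply: eq_big => [y|y yB].
      apply/idP/eqP => [yB|<-]; first exact: point_eq.
      by have [] := pointP a (col y) rB.
    rewrite (_ : B :\: hue col (col y) = B :\ y) //; apply/setP => x; rewrite !inE.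
    apply: andb_id2r => xB; congr negb; apply/eqP/eqP => [e|-> //].
    exact: (rainbow_inj rB).
  move=> y yB; apply: general_position_indep genX _ _ => //.
    by apply/eqP; rewrite -eqSS -cB (cardsD1 y B) yB.
  by move=> x /setD1P[_ /Bp].
- move=> a a' S S'; rewrite /h (eq_sym c0) (negbTE c10).
  by case: ifP => _; case: ifP => _; rewrite ?andbF // andbC.
Qed.

Lemma birch_alt (Y : {set X}) (P : {set {set X}}) :
  P \in good_partitions birch Y -> (d.+2 <= #|P|)%N ->
  exists2 P', P' \in good_partitions birch Y & P' != P.
Proof.
move=> gP dP; have : ~~ odd #|good_partitions birch Y|.
  by apply: birch_even => i; rewrite (card_birch_hue i gP).
rewrite (cardsD1 P) gP /= negbK => /odd_gt0/card_gt0P[P'].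
by rewrite !inE => /andP[nP' gP']; exists P'; rewrite ?inE.
Qed.

End ColoredBirch.

(** For a fixed sum the balanced product is smallest: if [a <= b], passing from [(a, b.+1)] to
    [(a.+1, b)] multiplies it by [(a + 1) / (b + 1) <= 1]. *)
Lemma leq_fact_uphalf_half (a b : nat) :
  ((uphalf (a + b))`! * ((a + b)./2)`! <= a`! * b`!)%N.
Proof.
wlog leab : a b / (a <= b)%N => [H|].
  by have [/H //|/ltnW/H] := leqP a b; rewrite addnC [X in (_ <= X)%N]mulnC.
have [n] := ubnP (b - a)%N; elim: n a b leab => // n IHn a b leab ltn.
have [leb|ltb] := leqP b a.+1.
  have -> : ((a + b)./2 = a)%N by lia.
  have -> : (uphalf (a + b) = b)%N by lia.
  by rewrite mulnC.
case: b => [|b] in leab ltn ltb *; first by lia.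
have := IHn a.+1 b; rewrite addSnnS => IH.
apply: leq_trans (IH _ _) _; try lia.
by rewrite !factS -mulnA [leqRHS]mulnCA leq_mul2r; apply/orP; right; lia.
Qed.

(** * Rematching blocks on the line *)

Section Line.
Variables (R : realType) (p : 'rV[R]_1) (X : {fset 'rV[R]_1}) (col : X -> 'I_2).

Local Notation lo x := ((val (x : X)) 0 0 <= p 0 0).
Local Notation hi x := (p 0 0 <= (val (x : X)) 0 0).

Lemma birch_block_pair (x y : X) : col x = 0 -> col y = 1 ->
  birch_block p col [set x; y] = (lo x && hi y) || (hi x && lo y).
Proof.
move=> cx cy.
have nxy : x != y by apply: contra_eq_neq cx => ->; rewrite cy.
have rB : rainbow col [set x; y].
  apply/forallP => i.
  have [e|e] : i = 0 \/ i = 1.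
    by case: i => -[|[|//]] ?; [left|right]; apply: val_inj.
  - rewrite (_ : _ :&: _ = [set x]) ?cards1 //; apply/setP => z; rewrite !inE e.
    have [->|nzx] := eqVneq z x; first by rewrite cx.
    by have [->|//] := eqVneq z y; rewrite cy.
  - rewrite (_ : _ :&: _ = [set y]) ?cards1 //; apply/setP => z; rewrite !inE e.
    have [->|nzx] := eqVneq z x; first by rewrite cx (negbTE nxy).
    by have [->|//] := eqVneq z y; rewrite cy.
have sum2 (V : nmodType) (F : X -> V) : \sum_(z in [set x; y]) F z = F x + F y.
  by rewrite big_setU1 ?inE //= big_set1.
rewrite birch_blockE rB /=; apply/asboolP/orP => [[w [w0 w1 wp]]|xpy].
  rewrite sum2 in w1; rewrite sum2 in wp.
  have wx : 0 <= w x by apply: w0; rewrite !inE eqxx.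
  have wy : 0 <= w y by apply: w0; rewrite !inE eqxx orbT.
  rewrite wp !mxE (_ : w y = 1 - w x) in wy *; last by lra.
  have [le|/ltW le] := leP (val x 0 0) (val y 0 0).
    left; apply/andP; split; nra.
  right; apply/andP; split; nra.
pose X0 := val x 0 0; pose Y0 := val y 0 0; pose P0 := p 0 0.
(* [l] is the barycentric coordinate of [p] at [x]; if [X0 == Y0], both equal [P0] and any weight
   works. *)
pose l := if X0 == Y0 then 1 else (Y0 - P0) / (Y0 - X0).
have [l0 l1 lP] : [/\ 0 <= l, l <= 1 & P0 = l * X0 + (1 - l) * Y0].
  rewrite /l; have [e|ne] := eqVneq X0 Y0.
    by split=> //; move: xpy; rewrite -/X0 -/Y0 -/P0 -e => -[]/andP[]; lra.
  have ne' : Y0 - X0 != 0 by rewrite subr_eq0 eq_sym.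
  case: xpy => /andP[]; rewrite -/X0 -/Y0 -/P0 => h1 h2.
    have gt0 : 0 < Y0 - X0 by rewrite lt_neqAle eq_sym ne' subr_ge0 (le_trans h1).
    split; [rewrite divr_ge0 ?subr_ge0 ?(ltW gt0) //|by rewrite ler_pdivrMr // mul1r; lra|by field].
    by rewrite -subr_ge0 ltW.
  have gt0 : 0 < X0 - Y0 by rewrite lt_neqAle eq_sym subr_eq0 ne subr_ge0 (le_trans h2).
  have eqf : (Y0 - P0) / (Y0 - X0) = (P0 - Y0) / (X0 - Y0).
    by rewrite -mulrNN -invrN !opprB.
  split; [by rewrite eqf divr_ge0 ?subr_ge0 // -subr_ge0 ltW
         |by rewrite eqf ler_pdivrMr // mul1r; lra|by field].
exists (fun z => if z == x then l else 1 - l); split.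
- by move=> z _; case: ifP => _ //; rewrite subr_ge0.
- by rewrite sum2 eqxx eq_sym (negbTE nxy) addrC subrK.
- rewrite sum2 eqxx eq_sym (negbTE nxy); apply/rowP => i; rewrite ord1 !mxE.
  exact: lP.
Qed.

(** Blocks are sorted by whether their point of colour 0 lies below or above [p]. Within one
    orientation all points of colour 0 match all points of colour 1, so the two orientations
    contribute independent factorials, whose product is least when balanced. *)
Lemma birch_line_lower (P : {set {set X}}) :
  P \in good_partitions (birch_block p col) [set: X] ->
  ((uphalf #|P|)`! * (#|P|./2)`! <= #|good_partitions (birch_block p col) [set: X]|)%N.
Proof.
move=> gP; have rP : P \in rainbow_partitions col [set: X].
  by move: gP; rewrite birch_partitionsE inE => /andP[].
pose plus (B : {set X}) := [exists x in B, exists y in B,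
  [&& col x == 0, col y == 1, lo x & hi y]].
pose Q (s : bool) := [set B in P | plus B == s].
pose A (s : bool) (i : 'I_2) := [set x in [set: X] :&: hue col i | plus (pblock P x) == s].
have cA s i : #|A s i| = #|Q s| := card_hue_pblock (fun B => plus B == s) i rP.
have cQ : (#|Q true| + #|Q false| = #|P|)%N.
  rewrite -(cardsID [set B | plus B] P); congr (_ + _)%N; apply: eq_card => B.
    by rewrite !inE; case: (plus _); rewrite ?andbF.
  by rewrite !inE; case: (plus _); rewrite ?andbF ?andbT.
have pbP x : pblock P x \in P /\ x \in pblock P x.
  exact: good_partition_pblock gP (in_setT x).
have rain B : B \in P -> rainbow col B.
  by move: rP; rewrite inE => /andP[_ /forall_inP]; apply.
have pairP B : B \in P -> exists x y, [/\ B = [set x; y], col x = 0, col y = 1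
   & (lo x && hi y) || (hi x && lo y)].
  move=> BP; have rB := rain _ BP.
  have [x xB cx] := rainbow_ex 0 rB; have [y yB cy] := rainbow_ex 1 rB.
  have eB : B = [set x; y].
    apply/esym/eqP; rewrite eqEcard subUset !sub1set xB yB (card_rainbow rB) card_ord.
    by rewrite cards2 (contra_eq_neq _ cx) // => ->; rewrite cy.
  exists x, y; split=> //; rewrite -birch_block_pair // -eB.
  by have [_] := good_partitionsP _ _ _ gP; apply.
have plusE x y : col x = 0 -> col y = 1 -> plus [set x; y] = lo x && hi y.
  move=> cx cy; apply/existsP/idP => [[u /andP[uB /existsP[w /and5P[wB cu cw lu hw]]]]|/andP[lx hy]].
    have -> : x = u.
      by move: uB; rewrite !inE => /orP[]/eqP // e; move: cu; rewrite e cy.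
    have -> : y = w.
      by move: wB; rewrite !inE => /orP[]/eqP // e; move: cw; rewrite e cx.
    by rewrite lu hw.
  exists x; rewrite !inE eqxx /=; apply/existsP; exists y.
  by rewrite !inE eqxx orbT cx cy !eqxx lx hy.
have A0 s x : x \in A s 0 -> if s then lo x else hi x.
  rewrite !inE => /andP[/eqP cx]; have [BP xB] := pbP x.
  have [u [w [eB cu cw h]]] := pairP _ BP; rewrite eB plusE //.
  have -> : x = u.
    by move: xB; rewrite eB !inE => /orP[]/eqP // e; move: cx; rewrite e cw.
  by move=> /eqP <-; case: (boolP (lo u && hi w)) h => [/andP[]//|_ /andP[]].
have A1 s y : y \in A s 1 -> if s then hi y else lo y.
  rewrite !inE => /andP[/eqP cy]; have [BP yB] := pbP y.
  have [u [w [eB cu cw h]]] := pairP _ BP; rewrite eB plusE //.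
  have -> : y = w.
    by move: yB; rewrite eB !inE => /orP[]/eqP // e; move: cy; rewrite e cu.
  by move=> /eqP <-; case: (boolP (lo u && hi w)) h => [/andP[]//|_ /andP[]].
have dA s s' i i' : (s != s') || (i != i') -> [disjoint A s i & A s' i'].
  move=> ne; rewrite disjoint_subset; apply/subsetP => x; rewrite !inE.
  move=> /andP[/eqP -> /eqP ->]; apply: contraL ne => /andP[/eqP -> /eqP ->].
  by rewrite !eqxx.
have good s x y : x \in A s 0 -> y \in A s 1 -> birch_block p col [set x; y].
  move=> xA yA; have := A0 _ _ xA; have := A1 _ _ yA.
  move: xA yA; rewrite !inE => /andP[/eqP cx _] /andP[/eqP cy _].
  by rewrite birch_block_pair //; case: (s) => -> ->; rewrite ?orbT.
(* The trailing [set0] has exactly one good partition and ends the two applications of [step]. *)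
have TE : [set: X] = A true 0 :|: A true 1 :|: (A false 0 :|: A false 1 :|: set0).
  apply/setP => x; rewrite !inE; case: (plus _) => /=; rewrite ?andbF ?andbT ?orbF.
    by case: (col x) => -[|[|//]] ?.
  by case: (col x) => -[|[|//]] ?.
have step s (W : {set X}) : [disjoint A s 0 :|: A s 1 & W] ->
    ((#|Q s|)`! * #|good_partitions (birch_block p col) W| <=
     #|good_partitions (birch_block p col) (A s 0%R :|: A s 1%R :|: W)|)%N.
  move=> dW; apply: fact_good_partitions (cA s 0) (cA s 1) _ dW (good s).
  by apply: dA; rewrite orbT.
rewrite -cQ; apply: leq_trans (leq_fact_uphalf_half _ _) _.
rewrite TE; apply: leq_trans _ (step true _ _); last first.
  rewrite -setI_eq0 !setIUl !setIUr !setI0.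
  by rewrite !(eqP (etrans (setI_eq0 _ _) (dA true false _ _ isT))) !setU0.
rewrite leq_mul2l; apply/orP; right; apply: leq_trans _ (step false _ _).
  by rewrite good_partitions0 muln1.
by rewrite -setI_eq0 setI0.
Qed.

End Line.

(** * Assembling the four claims *)

Local Open Scope fset_scope.
Local Open Scope nat_scope.

Theorem theorem1p2 (R : realType) (d k : nat) (p : 'rV[R]_d)
    (X : {fset 'rV[R]_d}) (col : X -> 'I_d.+1)
    (hd : 1 <= d) (hk : 1 <= k)
    (hX : #|` X| = k * d.+1)
    (hcol : forall i : 'I_d.+1, #|color_class col i| = k)
    (hgen : general_position (p |` X)) :
  [/\ d + 2 <= k -> ~~ odd (cBP p col k),
      d = 1 -> 0 < cBP p col k ->
        (uphalf k)`! * (k./2)`! <= cBP p col k,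
      d = 2 -> 6 <= k -> 0 < cBP p col k ->
        8 * 3 ^ (k - 6) <= cBP p col k
    & 2 <= d -> d + 2 <= k -> 0 < cBP p col k ->
        2 ^ (k - d - 1) <= cBP p col k ].
Proof.
rewrite (cBPE p col hX); split=> [dk|d1|d2 k6|d2 dk].
- apply: birch_even => // i; rewrite setTI; move: (hcol i); rewrite /color_class /hue => ->.
  by rewrite -addn2 in dk *; lia.
- case/card_gt0P => P gP; subst d.
  have <- : #|P| = k by rewrite -(card_birch_hue ord0 gP) setTI; apply: hcol.
  exact: birch_line_lower.
- case/card_gt0P => P gP.
  have cP : #|P| = k by rewrite -(card_birch_hue ord0 gP) setTI; apply: hcol.
  (* With [q = d.+2 = 4] the bound is [2 ^ 3 * 3 ^ m] for [m + 6] blocks. *)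
  have := exp3_good_partitions (ltn0Sn d) (@card_birch_block _ _ p X col) (birch_alt hd hgen) (m := k - 6) gP.
  by subst d; apply; rewrite cP; lia.
- case/card_gt0P => P gP.
  have cP : #|P| = k by rewrite -(card_birch_hue ord0 gP) setTI; apply: hcol.
  (* Here [q.-1 = d.+1], so [m = k - d - 1]. *)
  apply: (exp2_good_partitions (ltn0Sn d) (@card_birch_block _ _ p X col) (birch_alt hd hgen) gP).
  by rewrite cP; lia.
Qed.
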